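(* Let $M$ be a $d\times n$ real matrix with columns $v_1,\ldots,v_n$ satisfying $\|v_i\|_2\leq1$ for all $i\in[n]$, let $X\in\{\pm1\}^n$ be the random output of the Gram-Schmidt walk algorithm run on $M$, and let $v\in\mathbb{R}^d$. With the random variable $Z_v$ associated with this run as defined in the context, \[ \mathbf E\exp\left(\langle MX,v\rangle-\tfrac12Z_v\right)\leq1. \] Moreover, $Z_v\leq\|v\|_2^2$.
   Context: Notation: $[n]=\{1,\ldots,n\}$, and $\langle\cdot,\cdot\rangle$ is the Euclidean inner product. Gram-Schmidt walk (GSW) algorithm for a $d\times n$ matrix $M$ with columns $v_1,\ldots,v_n$. Set $X_1=\mathbf 0\in[-1,1]^n$, $t=1$, $\mathcal A_1=[n]$ (unfrozen indices), pivot $\boldsymbol{p}_1=n$. While $\mathcal A_t\neq\emptyset$: (1) let $u_t$ be a minimizer of $\|Mu\|_2$ over $u\in\mathbb{R}^n$ with $u(\boldsymbol p_t)=1$ and $u(i)=0$ for all $i\notin\mathcal A_t$ (chosen by a fixed rule if not unique); (2) let $\Delta=\{\delta\in\mathbb{R}: X_t+\delta u_t\in[-1,1]^n\}$, $\delta^+=|\max\Delta|$, $\delta^-=|\min\Delta|$; (3) let (with fresh randomness) $\delta_t=\delta^+$ with probability $\delta^-/(\delta^-+\delta^+)$ and $\delta_t=-\delta^-$ with probability $\delta^+/(\delta^-+\delta^+)$; (4) set $X_{t+1}=X_t+\delta_tu_t$, $\mathcal A_{t+1}=\{i\in[n]:|X_{t+1}(i)|<1\}$, $\boldsymbol p_{t+1}=\max\mathcal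 A_{t+1}$ (if $\mathcal A_{t+1}\ne\emptyset$), and increase $t$ by $1$. The output is $X=X_{T+1}\in\{\pm1\}^n$, where $T$ is the random number of steps, i.e. $\mathcal A_{T+1}=\emptyset$ for the first time; $T\leq n$. Pivots. $\mathcal P\subseteq[n]$ is the (random) set of indices that become pivots; for $\boldsymbol p\in\mathcal P$, $I_{\boldsymbol p}=\{t\leq T:\boldsymbol p_t=\boldsymbol p\}$ and $t_{\boldsymbol p}=\min I_{\boldsymbol p}$. Index $i$ is frozen in step $t$ if $i\in\mathcal A_t\setminus\mathcal A_{t+1}$. Order. The (random) permutation $\sigma$ of $[n]$ is built by assigning the values $\sigma(n),\sigma(n-1),\ldots,\sigma(1)$ successively: for $t=1,2,\ldots,T$, if $\boldsymbol p_t$ is a new pivot (or $t=1$), then the next value is $\boldsymbol p_t$; after that, the next values are the indices $j\neq\boldsymbol p_t$ frozen in step $t$, in decreasing order. Orthogonalisation. For $r=1,\ldots,n$, let $A_r$ be the orthogonal projection onto $\mathrm{Lin}(v_{\sigma(1)},\ldots,v_{\sigma(r-1)})$ (so $A_1=0$) and $w_{\sigma(r)}=\frac{v_{\sigma(r)}-A_rv_{\sigma(r)}}{\|v_{\sigma(r)}-A_rv_{\sigma(r)}\|_2}$, with $w_{\sigma(r)}=0$ if the numerator is $0$. Index sets. For $\boldsymbol p\in\mathcal P$ and integers $t\geq t_{\boldsymbol p}-1$: $Q^{\boldsymbol p}_{t}=\{\sigma^{-1}(\boldsymbol p)\}$ if $t=t_{\boldsymbol p}-1$; $Q^{\boldsymbol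 p}_t=\{\sigma^{-1}(j): j\in\mathcal A_t\setminus\mathcal A_{t+1},\ j\neq\boldsymbol p\}$ if $t\in I_{\boldsymbol p}$; $Q^{\boldsymbol p}_t=\emptyset$ otherwise. For $v\in\mathbb{R}^d$ define the random variable \[ Z_v=\sum_{\boldsymbol p\in\mathcal P}\left(\sum_{s=t_{\boldsymbol p}-1}^{n}\left|\sum_{r\in Q^{\boldsymbol p}_s}\langle w_{\sigma(r)},v_{\boldsymbol p}\rangle\langle w_{\sigma(r)},v\rangle\right|\right)^2 . \] *)

(* Defs.v *)
(* MathComp / MathComp-Analysis world. *)
From HB Require Import structures.
From mathcomp Require Import all_boot all_order all_algebra.
From mathcomp Require Import boolp classical_sets reals.
From mathcomp Require Import sequences exp.

Set Implicit Arguments.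
Unset Strict Implicit.
Unset Printing Implicit Defensive.

Import Order.TTheory GRing.Theory Num.Theory.

Local Open Scope ring_scope.

Section Euclidean.
Context {R : realType}.

Definition dot m (x y : 'cV[R]_m) : R := \sum_i x i 0 * y i 0.

(* The norm [`|x|] of the library on matrices is the sup norm. *)
Definition norm2 m (x : 'cV[R]_m) : R := Num.sqrt (dot x x).

(* Orthogonal projection of R^d onto the row space of [U], acting on columns.
   [kermx U^T] is the orthogonal complement of the row space of [U], and
   [proj_mx] acts on row vectors, hence the outer transpose. *)
Definition orth_proj d (U : 'M[R]_d) : 'M[R]_d := (proj_mx U (kermx U^T))^T.

End Euclidean.

(* Indices are 0-based: i : 'I_n stands for i + 1 in [n], and likewise for the
   positions r.  The times t of the walk are 1-based, t = 1, 2, ... *)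

Section GramSchmidtWalk.
Context {R : realType} {d n : nat}.
Implicit Types (M : 'M[R]_(d, n)) (x u : 'cV[R]_n) (A : {set 'I_n}).
Implicit Types (p : 'I_n) (b : bool) (t s : nat).

Definition feasible A p u : Prop :=
  u p 0 = 1 /\ forall i, i \notin A -> u i 0 = 0.

Definition is_direction M A p u : Prop :=
  feasible A p u /\
  forall u', feasible A p u' -> norm2 (M *m u) <= norm2 (M *m u').

(* A fixed rule choosing the minimizer: the minimization problem is determined
   by the set A of unfrozen indices and by the pivot p. *)
Definition direction_rule M (dir : {set 'I_n} -> 'I_n -> 'cV[R]_n) : Prop :=
  forall A p, p \in A -> is_direction M A p (dir A p).

Variable dir : {set 'I_n} -> 'I_n -> 'cV[R]_n.

(* At every time t (including t = 1, where x = 0) the unfrozen indices and the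
   pivot are functions of the current point x = X_t. *)
Definition unfrozen x : {set 'I_n} := [set i : 'I_n | `|x i 0| < 1]%SET.

(* The largest unfrozen index, [None] when the walk has stopped. *)
Definition pivot x : option 'I_n :=
  [pick p in unfrozen x | [forall i in unfrozen x, (i <= p)%N]].

Definition step_sizes x u : set R :=
  [set delta : R | forall i, -1 <= (x + delta *: u) i 0 <= 1]%classic.

(* In the walk [step_sizes x u] is a compact interval containing 0, so that
   [sup] and [inf] are its maximum and its minimum. *)
Definition delta_plus x u : R := `|sup (step_sizes x u)|.
Definition delta_minus x u : R := `|inf (step_sizes x u)|.

(* One step, given the outcome b of its coin; nothing moves once all indices
   are frozen. *)
Definition gsw_step x b : 'cV[R]_n :=
  if pivot x is Some p then
    let u := dir (unfrozen x) p in
    x + (if b then delta_plus x u else - delta_minus x u) *: u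
  else x.

(* Probability of the outcome b of the coin tossed at x.  Coins tossed after
   the walk has stopped are fair and have no effect. *)
Definition coin_prob x b : R :=
  if pivot x is Some p then
    let u := dir (unfrozen x) p in
    (if b then delta_minus x u else delta_plus x u)
      / (delta_minus x u + delta_plus x u)
  else 2^-1.

(* A run is determined by the outcomes of n coins (the walk makes at most n
   steps); the coin of step t is entry t - 1 of the tuple. *)
Section Run.
Variable c : n.-tuple bool.

Definition gsw_X t : 'cV[R]_n := foldl gsw_step 0 (take t.-1 c).

Definition gsw_A t : {set 'I_n} := unfrozen (gsw_X t).

Definition gsw_pivot t : option 'I_n := pivot (gsw_X t).

(* T: the number of k >= 0 preceding the first one with A_(k+1) empty. *)
Definition gsw_T : nat := find (fun k => gsw_A k.+1 == finset.set0) (iota 0 n).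

Definition gsw_output : 'cV[R]_n := gsw_X gsw_T.+1.

Definition gsw_frozen t : {set 'I_n} := (gsw_A t :\: gsw_A t.+1)%SET.

(* I_p, in increasing order. *)
Definition pivot_phase p : seq nat :=
  [seq t <- iota 1 gsw_T | gsw_pivot t == Some p].

Definition pivots : {set 'I_n} := [set p : 'I_n | pivot_phase p != [::]]%SET.

(* t_p = min I_p, for p in [pivots]. *)
Definition pivot_start p : nat := head 0%N (pivot_phase p).

(* The indices listed by step t: the pivot if it is new, i.e. if t = t_p, and
   then the other indices frozen in step t, in decreasing order. *)
Definition listed_at t : seq 'I_n :=
  if gsw_pivot t is Some p then
    (if pivot_start p == t then [:: p] else [::])
      ++ rev (enum (gsw_frozen t :\ p)%SET)
  else [::].

(* sigma(n), sigma(n - 1), ..., sigma(1) *)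
Definition gsw_order : seq 'I_n := flatten [seq listed_at t | t <- iota 1 gsw_T].

(* [gsw_order] has size n, so the default value of [nth] is never used. *)
Definition gsw_sigma (r : 'I_n) : 'I_n := nth r (rev gsw_order) r.

(* The projection onto the span of the v_(sigma k) with k < r. *)
Definition gsw_proj M (r : 'I_n) : 'M[R]_d :=
  orth_proj (\sum_(k < n | (k < r)%N) <<(col (gsw_sigma k) M)^T>>)%MS.

(* The vector w_(sigma r); it is 0 when the residual y is 0. *)
Definition gsw_w M (r : 'I_n) : 'cV[R]_d :=
  let v := col (gsw_sigma r) M in
  let y := v - gsw_proj M r *m v in
  (norm2 y)^-1 *: y.

(* Q^p_s; as sigma is a permutation, the image of a set under its inverse is
   written as a preimage under sigma. *)
Definition gsw_Q p s : {set 'I_n} :=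
  (if s == (pivot_start p).-1 then [set r | gsw_sigma r == p]
   else if s \in pivot_phase p then [set r | gsw_sigma r \in gsw_frozen s :\ p]
   else finset.set0)%SET.

Definition gsw_Z M (v : 'cV[R]_d) : R :=
  \sum_(p in pivots)
    (\sum_((pivot_start p).-1 <= s < n.+1)
       `|\sum_(r in gsw_Q p s)
           dot (gsw_w M r) (col p M) * dot (gsw_w M r) v|) ^+ 2.

(* The probability of the run. *)
Definition gsw_prob : R :=
  \prod_(1 <= t < n.+1) coin_prob (gsw_X t) (nth false c t.-1).

End Run.

Definition gsw_expectation (F : n.-tuple bool -> R) : R :=
  \sum_(c : n.-tuple bool) gsw_prob c * F c.

End GramSchmidtWalk.

(* Main.v *)
Require Import Defs.
From HB Require Import structures.
From mathcomp Require Import all_boot all_order all_algebra.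
From mathcomp Require Import boolp classical_sets reals.
From mathcomp Require Import sequences exp.
From mathcomp Require Import normedtype derive.
From mathcomp Require Import ring lra zify.

Set Implicit Arguments.
Unset Strict Implicit.
Unset Printing Implicit Defensive.

Import Order.TTheory GRing.Theory Num.Theory.
Import numFieldNormedType.Exports.

Local Open Scope ring_scope.

(** Write P_S for the orthogonal projection onto the span of the columns v_i
    with i in S. At a time with unfrozen set A and pivot p, minimality of the
    norm of M u says that M u is the residual v_p - P_(A - p) v_p
    ([direction_proj]). The sets A - p met along the run are initial segments
    of the order sigma, so that a sum over a block of vectors w telescopes to a
    difference of two projections ([sum_w_diff]). Hence the terms that Z_v
    collects for the pivot p are the absolute values of the increments of
    a_t = <M u_t, v> during the phase of p, starting from 0 ([sum_gsw_Q]). So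
    Z_v is the sum over p of f_p^2, where f_p accumulates these absolute values
    and is updated coin by coin, along with X_t ([walk_next]).

    For the exponential bound, let h(y, a) be the mean of exp (a (xi - y)) for
    a random sign xi of mean y ([coin_mgf]). The quantity
      exp (<M X_t, v> - 1/2 sum_q f_q^2) * h (X_t(p), a_t)
    is a supermartingale ([potential_step]). Keeping the direction, the second
    factor is the conditional mean of the contribution of the rest of the
    phase, which gives a martingale ([coin_mgf_martingale]). When indices get
    frozen, a changes by some e and f_p grows by |e|; since |a| <= f_p and
    |d/da log h(y, a)| <= |a|, the growth of h is absorbed by the decrease of
    exp (- f_p^2 / 2) ([coin_mgf_incr]). When p is frozen, h is equal to 1, and
    opening the next phase is a change of a from 0. At the end of the run the
    supermartingale is exp (<M X, v> - Z_v / 2).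

    For the bound on Z_v, Cauchy-Schwarz for a difference of nested projections
    bounds the square of an increment of a by the product of the energies
    <P x, x> lost in that step by x = v_p and by x = v. Adding up a phase by
    Cauchy-Schwarz, f_p^2 is at most |v_p|^2 <= 1 times the energy of v lost in
    the phase of p, and these energies add up to at most |v|^2
    ([energy_next]). *)

(** * Inner product and orthogonal projections *)

Section Dot.
Context {R : realType} {m : nat}.
Implicit Types x y z : 'cV[R]_m.

Lemma dotE x y : dot x y = (x^T *m y) 0 0.
Proof. by rewrite mxE; apply: eq_bigr => i _; rewrite mxE. Qed.

Lemma dotC x y : dot x y = dot y x.
Proof. by apply: eq_bigr => i _; rewrite mulrC. Qed.

Lemma dotDl x y z : dot (x + y) z = dot x z + dot y z.
Proof. by rewrite !dotE linearD mulmxDl mxE. Qed.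

Lemma dotBl x y z : dot (x - y) z = dot x z - dot y z.
Proof. by rewrite !dotE linearB mulmxBl !mxE. Qed.

Lemma dotZl a x y : dot (a *: x) y = a * dot x y.
Proof. by rewrite !dotE linearZ -scalemxAl mxE. Qed.

Lemma dotDr x y z : dot z (x + y) = dot z x + dot z y.
Proof. by rewrite dotC dotDl !(dotC z). Qed.

Lemma dotBr x y z : dot z (x - y) = dot z x - dot z y.
Proof. by rewrite dotC dotBl !(dotC z). Qed.

Lemma dotZr a x y : dot y (a *: x) = a * dot y x.
Proof. by rewrite dotC dotZl (dotC y). Qed.

Lemma dot0l x : dot 0 x = 0.
Proof. by rewrite -(scale0r (0 : 'cV_m)) dotZl mul0r. Qed.

Lemma dot_ge0 x : 0 <= dot x x.
Proof. by apply: sumr_ge0 => i _; rewrite -expr2 sqr_ge0. Qed.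

Lemma dot_eq0 x : (dot x x == 0) = (x == 0).
Proof.
apply/eqP/eqP => [x0|->]; last exact: dot0l.
apply/matrixP => i j; rewrite ord1 mxE; apply/eqP.
rewrite -sqrf_eq0 expr2.
have := x0; rewrite /dot => /eqP; rewrite psumr_eq0 => [/allP/(_ i)|k _];
  last first.
  by rewrite -expr2 sqr_ge0.
by rewrite mem_index_enum /= => /(_ isT).
Qed.

Lemma norm2_sqr x : norm2 x ^+ 2 = dot x x.
Proof. by rewrite sqr_sqrtr ?dot_ge0. Qed.

Lemma dot_Cauchy_Schwarz x y : dot x y ^+ 2 <= dot x x * dot y y.
Proof.
have [/eqP|y0] := eqVneq (dot y y) 0.
  by rewrite dot_eq0 => /eqP ->; rewrite dotC !dot0l expr0n mulr0.
have yy : 0 < dot y y by rewrite lt_neqAle eq_sym y0 dot_ge0.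
have := dot_ge0 (dot y y *: x - dot x y *: y).
rewrite !(dotBl, dotBr, dotZl, dotZr) (dotC y x).
set a := dot x y; set b := dot y y; set c := dot x x => h.
have : 0 <= b * (c * b - a ^+ 2) by rewrite (le_trans h) // le_eqVlt;
  apply/orP; left; apply/eqP; ring.
by rewrite pmulr_rge0 // subr_ge0.
Qed.

End Dot.

Section OrthProj.
Context {R : realType} {d : nat}.
Implicit Types (U : 'M[R]_d) (x y z : 'cV[R]_d).

Lemma sub_span_dot0 U x y : (x^T <= kermx U^T)%MS -> (y^T <= U)%MS ->
  dot x y = 0.
Proof.
move=> /sub_kermxP xU /submxP[w yw].
by rewrite dotE -[y]trmxK yw trmx_mul mulmxA xU mul0mx mxE.
Qed.

Lemma cap_orth_compl U : (U :&: kermx U^T = 0)%MS.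
Proof.
apply/eqP; rewrite -submx0; apply/rV_subP => w;
  rewrite sub_capmx => /andP[wU wK].
rewrite -(trmxK w) in wU wK *.
by move: (sub_span_dot0 wK wU) => /eqP; rewrite dot_eq0 => /eqP ->;
  rewrite trmx0 sub0mx.
Qed.

Lemma add_orth_compl U (w : 'rV[R]_d) : (w <= U + kermx U^T)%MS.
Proof.
apply: submx_full; rewrite /row_full.
have := mxrank_sum_cap U (kermx U^T).
rewrite cap_orth_compl mxrank0 addn0 => ->.
by rewrite mxrank_ker mxrank_tr subnKC // rank_leq_col.
Qed.

Lemma orth_proj_sub U x : ((orth_proj U *m x)^T <= U)%MS.
Proof. by rewrite trmx_mul trmxK proj_mx_sub. Qed.

Lemma orth_proj_orth U x y : (y^T <= U)%MS -> dot (x - orth_proj U *m x) y = 0.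
Proof.
apply: sub_span_dot0; rewrite linearB /= trmx_mul trmxK.
exact: proj_mx_compl_sub (add_orth_compl _ _).
Qed.

(** The two properties that determine the projection; all later computations
    of projections go through this characterisation. *)
Lemma orth_proj_uniq U x z :
  (z^T <= U)%MS -> (forall y, (y^T <= U)%MS -> dot (x - z) y = 0) ->
  orth_proj U *m x = z.
Proof.
move=> zU xz; set p := _ *m x.
have pzU : ((p - z)^T <= U)%MS.
  by rewrite linearB /= addmx_sub ?orth_proj_sub // eqmx_opp.
apply/eqP; rewrite -subr_eq0 -dot_eq0.
have e : p - z = (x - z) - (x - p) by rewrite opprB [RHS]addrC subrKA.
by rewrite {1}e dotBl xz // orth_proj_orth // subrr.
Qed.

Lemma orth_proj_id U x : (x^T <= U)%MS -> orth_proj U *m x = x.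
Proof. by move=> xU; apply: orth_proj_uniq => // y _; rewrite subrr dot0l. Qed.

Lemma dot_orth_proj U x y : (y^T <= U)%MS -> dot (orth_proj U *m x) y = dot x y.
Proof.
by move=> /(orth_proj_orth x); rewrite dotBl => /eqP; rewrite subr_eq0 => /eqP.
Qed.

Lemma dot_orth_proj2 U x y :
  dot (orth_proj U *m x) (orth_proj U *m y) = dot (orth_proj U *m x) y.
Proof.
by rewrite dotC (dotC _ y) dot_orth_proj ?orth_proj_sub.
Qed.

(** A difference of nested orthogonal projections is itself an orthogonal
    projection. *)
Lemma dot_orth_projB U V x y
    (D := fun z => orth_proj U *m z - orth_proj V *m z) :
  (V <= U)%MS ->
  dot (D x) y = dot (D x) (D y).
Proof.
move=> VU; have PVU z : ((orth_proj V *m z)^T <= U)%MS.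
  exact: submx_trans (orth_proj_sub _ _) VU.
have DU : ((D x)^T <= U)%MS.
  by rewrite linearB /= addmx_sub ?orth_proj_sub // eqmx_opp.
rewrite {3}/D dotBr (dotC _ (orth_proj U *m y)) (dot_orth_proj y DU) (dotC y).
rewrite /D (dotBl _ _ (orth_proj V *m y)) (dot_orth_proj x (PVU y)).
by rewrite (dot_orth_proj x (orth_proj_sub V y)) subrr subr0.
Qed.

Lemma orth_projB_Cauchy_Schwarz U V x y
    (D := fun z => orth_proj U *m z - orth_proj V *m z) :
  (V <= U)%MS ->
  dot (D x) y ^+ 2 <= dot (D x) x * dot (D y) y.
Proof.
move=> VU; rewrite /D (dot_orth_projB x y VU) (dot_orth_projB x x VU).
by rewrite (dot_orth_projB y y VU); exact: dot_Cauchy_Schwarz.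
Qed.

Lemma orth_proj_contract U x : dot (orth_proj U *m x) x <= dot x x.
Proof.
have := dot_ge0 (x - orth_proj U *m x).
rewrite dotBr (orth_proj_orth x (orth_proj_sub U x)) subr0.
by rewrite dotBl subr_ge0.
Qed.

End OrthProj.

Section ColSpan.
Context {R : realType} {d n : nat}.
Variable M : 'M[R]_(d, n).
Implicit Types (S : {set 'I_n}) (j : 'I_n) (x y z : 'cV[R]_d).

Definition col_span S : 'M[R]_d := (\sum_(i in S) <<(col i M)^T>>)%MS.

Definition span_proj S : 'M[R]_d := orth_proj (col_span S).

Lemma col_span_mem S i : i \in S -> ((col i M)^T <= col_span S)%MS.
Proof. by move=> iS; rewrite (sumsmx_sup i) ?genmxE. Qed.

Lemma col_spanS S S' : S' \subset S -> (col_span S' <= col_span S)%MS.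
Proof.
move=> /fintype.subsetP S'S; apply/sumsmx_subP => i iS'.
by rewrite genmxE col_span_mem ?S'S.
Qed.

Lemma col_span_orth S x y : (forall i, i \in S -> dot x (col i M) = 0) ->
  (y^T <= col_span S)%MS -> dot x y = 0.
Proof.
move=> xS yS.
have : (y^T <= kermx x)%MS.
  apply: submx_trans yS _; apply/sumsmx_subP => i iS; rewrite genmxE.
  apply/sub_kermxP/matrixP => a b; rewrite !ord1 [RHS]mxE -dotE dotC.
  exact: xS.
by move=> /sub_kermxP h; rewrite dotC dotE h mxE.
Qed.

Lemma span_proj_uniq S x z : (z^T <= col_span S)%MS ->
  (forall i, i \in S -> dot (x - z) (col i M) = 0) -> span_proj S *m x = z.
Proof.
by move=> zS xz; apply: orth_proj_uniq => // y; apply: col_span_orth.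
Qed.

(** One Gram-Schmidt step. If the residual y vanishes then so does w, and the
    span does not grow. *)
Lemma span_proj_add1 S j x :
  let y := col j M - span_proj S *m col j M in
  let w := (norm2 y)^-1 *: y in
  span_proj (j |: S) *m x = span_proj S *m x + dot w x *: w.
Proof.
move=> y w.
have spS z : ((span_proj S *m z)^T <= col_span (j |: S))%MS.
  by apply: (submx_trans (orth_proj_sub (col_span S) z)); apply: col_spanS;
    apply/finset.subsetUr.
have yS z : (z^T <= col_span S)%MS -> dot y z = 0 by apply: orth_proj_orth.
have ww z : dot w z *: w = (dot y y)^-1 * dot y z *: y.
  rewrite /w dotZl scalerA mulrAC -expr2 exprVn.
  by rewrite norm2_sqr.
rewrite ww; apply: span_proj_uniq => [|i].
  rewrite linearD linearZ /= addmx_sub // scalemx_sub // linearB /=.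
  by rewrite addmx_sub ?eqmx_opp ?spS // col_span_mem // setU11.
have orthS i0 : i0 \in S ->
    dot (x - (span_proj S *m x + (dot y y)^-1 * dot y x *: y)) (col i0 M) = 0.
  move=> iS; rewrite opprD addrA dotBl dotZl orth_proj_orth ?col_span_mem //.
  by rewrite (yS (col i0 M)) ?col_span_mem // mulr0 subrr.
rewrite in_setU1 => /predU1P[->|]; last exact: orthS.
rewrite -[col j M](subrK (span_proj S *m col j M)) -/y dotDr.
rewrite [X in _ + X](@col_span_orth S) ?orth_proj_sub // addr0.
rewrite opprD addrA dotBl dotZl dotBl (dotC (_ *m x)) yS ?orth_proj_sub //
  subr0.
have [y0|y0] := eqVneq (dot y y) 0.
  by move/eqP: y0; rewrite dot_eq0 => /eqP ->;
    rewrite (dotC x) !dot0l mulr0 subrr.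
by rewrite mulrAC mulVf // mul1r (dotC x) subrr.
Qed.

End ColSpan.

(** * Exponential moments of a random sign *)

Section Calculus.
Context {R : realType}.

Lemma le_of_derive_ge0 (f df : R -> R) (a b : R) :
  (forall x : R, is_derive x 1 f (df x)) -> (forall x, a <= x -> 0 <= df x) ->
  a <= b -> f a <= f b.
Proof.
move=> fdf df0 ab.
have [|c] := MVT_segment ab (fun x _ => fdf x).
  apply: derivable_within_continuous => x _; exact: ex_derive.
rewrite in_itv/= => /andP[ac _] /eqP; rewrite subr_eq addrC => /eqP ->.
by rewrite lerDl mulr_ge0 ?subr_ge0 ?df0.
Qed.

(** This is tanh (a / 2) <= a / 2, cleared of denominators. *)
Lemma expR_half_tanh (a : R) : 0 <= a -> 2 * (expR a - 1) <= a * (expR a + 1).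
Proof.
move=> a0.
pose f (x : R) := x * (expR x + 1) - 2 * (expR x - 1).
suff : f 0 <= f a by rewrite /f expR0 mul0r !subrr mulr0 subr0 subr_ge0.
apply: (@le_of_derive_ge0 f (fun x => 1 + (x - 1) * expR x)) => // x.
  rewrite /f; apply: is_derive_eq.
  by rewrite /GRing.scale /=; ring.
move=> _.
have h : (1 - x) * expR x <= 1.
  rewrite -ler_pdivlMr ?expR_gt0 // -expRN mul1r.
  exact: expR_ge1Dx.
lra.
Qed.

(** The mean of exp (a (xi - y)), where xi is 1 or -1 and has mean y. *)
Definition coin_mgf (y a : R) : R :=
  expR (- (a * y)) * ((1 + y) / 2 * expR a + (1 - y) / 2 * expR (- a)).

(** Up to a common positive factor, the left side is the derivative of
    [coin_mgf y] at a, and the right side is a times its value. AM-GM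
    eliminates y, and what remains is [expR_half_tanh]. *)
Lemma coin_mgf_slope (y a : R) : -1 <= y <= 1 -> 0 <= a ->
  (1 - y ^+ 2) * (expR a - expR (- a)) <=
  a * ((1 + y) * expR a + (1 - y) * expR (- a)).
Proof.
move=> /andP[y1 y2] a0.
have := expR_half_tanh a0.
rewrite expRN; have := expR_gt0 a; set e := expR a => e0 h.
have ei0 : 0 < e^-1 by rewrite invr_gt0.
have ee : e * e^-1 = 1 by rewrite divff // gt_eqF.
set g := e^-1 in ei0 ee *.
set p := 1 + y; set q := 1 - y.
have p0 : 0 <= p by rewrite /p; lra.
have q0 : 0 <= q by rewrite /q; lra.
have -> : 1 - y ^+ 2 = p * q by rewrite /p /q; ring.
have h2 : 2 * (e - g) <= a * (2 + e + g).
  have -> : 2 * (e - g) = g * (e + 1) * (2 * (e - 1)).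
    transitivity (2 * (e * e * g - g)); last by ring.
    by rewrite -mulrA ee mulr1.
  have -> : a * (2 + e + g) = g * (e + 1) * (a * (e + 1)).
    transitivity (a * (2 * (e * g) + e * (e * g) + g)); last by ring.
    by rewrite ee !mulr1.
  by rewrite ler_pM2l // mulr_gt0 // addr_gt0.
(* As p + q = 2 and e g = 1, the difference is g (p e - q)^2. *)
have h3 : p * q * (2 + e + g) <= 2 * (p * e + q * g).
  have -> : 2 * (p * e + q * g) = (p + q) * (p * e + q * g) by rewrite /p /q;
    ring.
  rewrite -subr_ge0.
  have -> : (p + q) * (p * e + q * g) - p * q * (2 + e + g) =
     g * (p * e - q) ^+ 2 + (1 - e * g) * (p ^+ 2 * e  - 2 * p * q) by ring.
  by rewrite ee subrr mul0r addr0 mulr_ge0 ?sqr_ge0 // ltW.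
have := ler_wpM2l a0 h3; have := ler_wpM2l (mulr_ge0 p0 q0) h2.
lra.
Qed.

(** The left side decreases in e: the logarithmic derivative of [coin_mgf y]
    at a + e is at most |a + e|, hence at most B + e. *)
Lemma coin_mgf_incr_pos (y a B e : R) : -1 <= y <= 1 -> `|a| <= B -> 0 <= e ->
  coin_mgf y (a + e) * expR (- (2^-1 * (B + e) ^+ 2)) <=
  coin_mgf y a * expR (- (2^-1 * B ^+ 2)).
Proof.
move=> yI aB e0.
pose f (x : R) := - (coin_mgf y (a + x) * expR (- (2^-1 * (B + x) ^+ 2))).
pose df (x : R) := expR (- ((a + x) * y)) * expR (- (2^-1 * (B + x) ^+ 2)) / 2
  * ((B + x) * ((1 + y) * expR (a + x) + (1 - y) * expR (- (a + x)))
     - (1 - y ^+ 2) * (expR (a + x) - expR (- (a + x)))).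
suff : f 0 <= f e by rewrite /f lerN2 !addr0.
apply: (@le_of_derive_ge0 f df) => // x.
  rewrite /f /coin_mgf; apply: is_derive_eq.
  by rewrite /GRing.scale /= /df; field.
move=> x0; rewrite /df; apply: mulr_ge0.
  by rewrite divr_ge0 // mulr_ge0 // expR_ge0.
have y1 : 0 <= 1 + y by move/andP: yI => []; lra.
have y2 : 0 <= 1 - y by move/andP: yI => []; lra.
have s0 : 0 <= (1 + y) * expR (a + x) + (1 - y) * expR (- (a + x)).
  by rewrite addr_ge0 // mulr_ge0 ?expR_ge0.
move: aB; rewrite ler_norml => /andP[aB1 aB2].
rewrite subr_ge0; have [ax|ax] := leP 0 (a + x).
  apply: le_trans (coin_mgf_slope yI ax) _.
  by apply: ler_wpM2r => //; lra.
apply: (@le_trans _ _ 0); last by rewrite mulr_ge0 //; lra.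
rewrite mulr_ge0_le0 //.
  by rewrite (_ : 1 - y ^+ 2 = (1 + y) * (1 - y)) ?mulr_ge0 //; ring.
by rewrite subr_le0 ler_expR; lra.
Qed.

Lemma coin_mgfNN y a : coin_mgf (- y) (- a) = coin_mgf y a.
Proof. by rewrite /coin_mgf mulrNN !opprK addrC. Qed.

(** Changing the slope a by e costs no more than what the exponential loses
    when a bound B on |a| is increased by |e|. *)
Lemma coin_mgf_incr (y a B e : R) : -1 <= y <= 1 -> `|a| <= B ->
  coin_mgf y (a + e) * expR (- (2^-1 * (B + `|e|) ^+ 2)) <=
  coin_mgf y a * expR (- (2^-1 * B ^+ 2)).
Proof.
move=> yI aB; have [e0|e0] := leP 0 e.
  by rewrite ?ger0_norm // coin_mgf_incr_pos.
rewrite ltr0_norm // -coin_mgfNN opprD -(coin_mgfNN y a).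
apply: coin_mgf_incr_pos; [lra|by rewrite normrN|lra].
Qed.

Lemma coin_mgf_ge0 y a : -1 <= y <= 1 -> 0 <= coin_mgf y a.
Proof.
move=> /andP[y1 y2]; rewrite mulr_ge0 ?expR_ge0 // addr_ge0 //;
  by rewrite mulr_ge0 ?expR_ge0 //; lra.
Qed.

Lemma coin_mgf0 y : coin_mgf y 0 = 1.
Proof. by rewrite /coin_mgf mul0r oppr0 expR0 !mulr1 mul1r; field. Qed.

(** Hoeffding's lemma for a random sign, as the change of slope from 0 to a. *)
Lemma coin_mgf_le (y a : R) : -1 <= y <= 1 ->
  coin_mgf y a * expR (- (2^-1 * `|a| ^+ 2)) <= 1.
Proof.
move=> yI.
have := @coin_mgf_incr y 0 0 a yI; rewrite normr0 lexx => /(_ isT).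
by rewrite !add0r coin_mgf0 expr0n /= mulr0 oppr0 expR0 mulr1.
Qed.

Lemma coin_mgf_end (y a : R) : `|y| = 1 -> coin_mgf y a = 1.
Proof.
have h1 (c : R) : coin_mgf 1 c = 1.
  rewrite /coin_mgf subrr mul0r mul0r addr0 mulr1 expRN.
  by rewrite (_ : (1 + 1) / 2 = 1 :> R) ?mul1r; [rewrite mulVf ?expR_eq0|field].
move=> y1; have /eqP : y ^+ 2 = 1 by rewrite -real_normK ?num_real // y1 expr1n.
rewrite sqrf_eq1 => /orP[/eqP -> //|/eqP ->].
by rewrite -(opprK a) coin_mgfNN.
Qed.

(** After the factor exp (- a y) is taken out, the quantity averaged is affine
    in the step; the step is s or - t and has mean 0. *)
Lemma coin_mgf_martingale (y a s t : R) : 0 < s + t ->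
  t / (t + s) * (expR (s * a) * coin_mgf (y + s) a)
  + s / (t + s) * (expR (- t * a) * coin_mgf (y - t) a) = coin_mgf y a.
Proof.
move=> st0; have ts0 : t + s != 0 by rewrite addrC gt_eqF.
have e (z : R) : expR (z * a) * coin_mgf (y + z) a = expR (- (a * y)) *
  ((1 + (y + z)) / 2 * expR a + (1 - (y + z)) / 2 * expR (- a)).
  by rewrite /coin_mgf mulrA -expRD; congr (expR _ * _); ring.
by rewrite !e /coin_mgf; field.
Qed.

End Calculus.

(** * Direction and length of a step *)

Section Direction.
Context {R : realType} {d n : nat}.
Variable M : 'M[R]_(d, n).
Implicit Types (A : {set 'I_n}) (p i : 'I_n) (u : 'cV[R]_n).

Lemma mulmx_col_sum u : M *m u = \sum_i u i 0 *: col i M.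
Proof.
apply/matrixP => a b; rewrite ord1 mxE summxE; apply: eq_bigr => i _.
by rewrite !mxE mulrC.
Qed.

(** Moving u along a coordinate i other than p keeps it feasible, so that the
    first variation of |M u|^2 in the direction v_i vanishes. *)
Lemma direction_orth A p u i : is_direction M A p u -> i \in A :\ p ->
  dot (M *m u) (col i M) = 0.
Proof.
move=> [[up uA] umin] /setD1P[ip iA].
set x := M *m u; set y := col i M.
have feas (e : R) : dot x x <= dot (x + e *: y) (x + e *: y).
  rewrite -!norm2_sqr ler_sqr ?nnegrE ?sqrtr_ge0 //.
  have -> : x + e *: y = M *m (u + e *: delta_mx i 0).
    by rewrite mulmxDr -scalemxAr -colE.
  apply: umin; split=> [|k kA]; rewrite !mxE.
    by rewrite up eq_sym (negPf ip) mulr0 addr0.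
  rewrite uA // (_ : k == i = false) ?mulr0 ?addr0 //.
  by apply: contraNF kA => /eqP ->.
have {}feas e : 0 <= e * (2 * dot x y + e * dot y y).
  by have := feas e; rewrite !(dotDl, dotDr, dotZl, dotZr) (dotC y x); lra.
have yy := dot_ge0 y; set b := dot y y in feas yy; set a := dot x y in feas *.
(* b + 1 replaces the optimal denominator b, which may be 0. *)
have := feas (- a / (b + 1)).
have -> : - a / (b + 1) * (2 * a + - a / (b + 1) * b)
   = - (a ^+ 2 * ((b + 2) / (b + 1) ^+ 2)).
  by field; lra.
rewrite oppr_ge0 pmulr_lle0; last by rewrite divr_gt0 ?exprn_gt0 //; lra.
by rewrite real_exprn_even_le0 ?num_real //= => /eqP.
Qed.

Lemma direction_proj A p u : is_direction M A p u ->
  M *m u = col p M - span_proj M (A :\ p) *m col p M.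
Proof.
move=> du; have [[up uA] _] := du.
suff -> : span_proj M (A :\ p) *m col p M = col p M - M *m u.
  by rewrite opprB addrC subrK.
apply: span_proj_uniq => [|i iA].
  rewrite mulmx_col_sum (bigD1 p) //= up scale1r opprD addrA subrr add0r.
  rewrite linearN linear_sum /= eqmx_opp summx_sub // => i ip.
  rewrite linearZ /=; have [iA|iA] := boolP (i \in A).
    by rewrite scalemx_sub // col_span_mem // in_setD1 ip.
  by rewrite uA // scale0r sub0mx.
by rewrite opprB addrC subrK (direction_orth du).
Qed.

End Direction.

Section Boundary.
Context {R : realType} {n : nat}.
Implicit Types (x u : 'cV[R]_n) (p i : 'I_n).

Definition in_cube x := [forall i, `|x i 0| <= 1].

Lemma step_sizes_opp x u :
  step_sizes x (- u) = [set - e | e in step_sizes x u]%classic.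
Proof.
apply/seteqP; split => [e h|_ [e h <-]] /=; last by move=> i;
  rewrite scalerN scaleNr opprK.
by exists (- e); rewrite ?opprK // => i; have := h i; rewrite scalerN scaleNr.
Qed.

(** For a coordinate k with u_k <> 0, [room k] is the step length left
    before k reaches the face of the cube it moves towards. The supremum is
    the smallest of these lengths, and a coordinate that realises it gets
    frozen. The statement asks for u_p <> 0 only, so that it also applies to
    - u, which turns infima into suprema. *)
Lemma sup_step_sizes x u p : in_cube x -> u p 0 != 0 ->
  (forall i, i \notin unfrozen x -> u i 0 = 0) ->
  let e := sup (step_sizes x u) in
  [/\ 0 < e, in_cube (x + e *: u) &
      exists2 i, i \in unfrozen x & i \notin unfrozen (x + e *: u)].
Proof.
move=> /forallP xc up uA.
pose room i := (1 - Num.sg (u i 0) * x i 0) / `|u i 0|.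
have [i ui imin] :
    exists2 i, u i 0 != 0 & forall k, u k 0 != 0 -> room i <= room k.
  by case: (arg_minP (P := fun k => u k 0 != 0) room up) => i ui h; exists i.
have inA k : u k 0 != 0 -> k \in unfrozen x by apply: contraR => /uA ->.
have room_gt0 k : u k 0 != 0 -> 0 < room k.
  move=> uk; rewrite divr_gt0 ?normr_gt0 // subr_gt0.
  apply: le_lt_trans (ler_norm _) _; rewrite normrM normr_sg uk mul1r.
  by have := inA k uk; rewrite inE.
have coordE k e : u k 0 != 0 ->
    Num.sg (u k 0) * (x + e *: u) k 0 = 1 - (room k - e) * `|u k 0|.
  move=> uk; rewrite mulrBl divfK ?normr_eq0 // !mxE mulrDr mulrCA -normrEsg.
  by ring.
have norm_sg k z : u k 0 != 0 -> `|Num.sg (u k 0) * z| = `|z|.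
  by move=> uk; rewrite normrM normr_sg uk mul1r.
have step_in : in_cube (x + room i *: u).
  apply/forallP => k; have [uk|uk] := eqVneq (u k 0) 0.
    by rewrite !mxE uk mulr0 addr0.
  rewrite -(norm_sg k) // ler_norml coordE // lerBlDr lerDl.
  rewrite mulr_ge0 ?subr_ge0 ?imin // andbT -coordE // !mxE mulrDr mulrCA
    -normrEsg.
  have : `|Num.sg (u k 0) * x k 0| <= 1 by rewrite norm_sg.
  rewrite ler_norml => /andP[+ _].
  have := mulr_ge0 (ltW (room_gt0 i ui)) (normr_ge0 (u k 0)); lra.
have eE : sup (step_sizes x u) = room i.
  have inS : step_sizes x u (room i).
    by move=> k; rewrite -ler_norml; apply: (forallP step_in).
  have ub : ubound (step_sizes x u) (room i).
    move=> e /(_ i); rewrite -ler_norml -(norm_sg i) //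
      => /(le_trans (ler_norm _)).
    rewrite coordE // gerBl pmulr_lge0 ?normr_gt0 // subr_ge0; exact.
  apply/eqP; rewrite eq_le ge_sup //=; last by exists (room i).
  by apply: ub_le_sup => //; exists (room i).
rewrite eE; split; [exact: room_gt0|exact: step_in|exists i; first exact: inA].
by rewrite inE -(norm_sg i) // coordE // subrr mul0r subr0 normr1 ltxx.
Qed.

End Boundary.

Section Step.
Context {R : realType} {n : nat}.
Variable dir : {set 'I_n} -> 'I_n -> 'cV[R]_n.
Hypothesis dir_feasible : forall (A : {set 'I_n}) p,
  p \in A -> feasible A p (dir A p).
Implicit Types (x y u : 'cV[R]_n) (p q i : 'I_n) (b : bool).

Lemma pivot_Some x p :
  pivot x = Some p <->
  p \in unfrozen x /\ forall i, i \in unfrozen x -> (i <= p)%N.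
Proof.
rewrite /pivot; split => [|[pA pmax]]; case: pickP => [q|] //.
- by move=> /andP[qA /forall_inP qmax] [<-].
- move=> /andP[qA /forall_inP qmax]; congr Some; apply/val_inj/anti_leq.
  by rewrite qmax // pmax.
- by move=> /(_ p); rewrite pA /= => /negbT /forall_inP[].
Qed.

Lemma pivot_None x : pivot x = None <-> unfrozen x = finset.set0.
Proof.
split; last first.
  by move=> A0; rewrite /pivot; case: pickP => // p; rewrite A0 inE.
move=> px; apply/eqP; apply: contraPT px => /set0Pn[i0 iA].
case: (arg_maxnP (P := [in unfrozen x]) val iA) => p pA pmax.
by rewrite (_ : pivot x = Some p) //; apply/pivot_Some.
Qed.

Lemma pivot_unfrozen x p : pivot x = Some p -> p \in unfrozen x.
Proof. by move=> /pivot_Some[]. Qed.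

Lemma pivot_stays x y p : unfrozen y \subset unfrozen x ->
  pivot x = Some p -> p \in unfrozen y -> pivot y = Some p.
Proof.
move=> /fintype.subsetP yx /pivot_Some[pA pmax] pA'.
by apply/pivot_Some; split => // i /yx /pmax.
Qed.

Definition step_delta x u b : R :=
  if b then delta_plus x u else - delta_minus x u.

Lemma step_deltaP x u p b : in_cube x -> u p 0 != 0 ->
  (forall i, i \notin unfrozen x -> u i 0 = 0) ->
  [/\ 0 < (if b then delta_plus x u else delta_minus x u),
      in_cube (x + step_delta x u b *: u) &
      exists2 i, i \in unfrozen x &
        i \notin unfrozen (x + step_delta x u b *: u)].
Proof.
move=> xc up uA; rewrite /step_delta; case: b.
  have [e0 ec ei] := sup_step_sizes xc up uA.
  by rewrite /delta_plus gtr0_norm.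
have [| |e0 ec ei] := @sup_step_sizes _ _ x (- u) p xc.
- by rewrite mxE oppr_eq0.
- by move=> i /uA; rewrite mxE => ->; rewrite oppr0.
move: e0 ec ei; rewrite step_sizes_opp scalerN -scaleNr.
by rewrite /delta_minus /inf normrN => e0; rewrite gtr0_norm.
Qed.

Lemma gsw_step_pivot x p b : pivot x = Some p ->
  gsw_step dir x b =
  x + step_delta x (dir (unfrozen x) p) b *: dir (unfrozen x) p.
Proof. by rewrite /gsw_step => ->; case: b. Qed.

Lemma gsw_step_None x b : pivot x = None -> gsw_step dir x b = x.
Proof. by rewrite /gsw_step => ->. Qed.

Lemma gsw_step_cube x b : in_cube x -> in_cube (gsw_step dir x b).
Proof.
move=> xc; case px: (pivot x) => [p|]; last by rewrite gsw_step_None.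
have [up uA] := dir_feasible (pivot_unfrozen px).
rewrite (gsw_step_pivot b px).
by have [||] := @step_deltaP x (dir (unfrozen x) p) p b xc;
  rewrite ?up ?oner_eq0.
Qed.

Lemma gsw_step_sub x b : unfrozen (gsw_step dir x b) \subset unfrozen x.
Proof.
case px: (pivot x) => [p|]; last by rewrite gsw_step_None.
have [up uA] := dir_feasible (pivot_unfrozen px).
apply/fintype.subsetP => i; apply: contraLR => iA.
by rewrite (gsw_step_pivot b px) inE !mxE uA // mulr0 addr0; rewrite inE in iA.
Qed.

Lemma gsw_step_proper x p b : in_cube x -> pivot x = Some p ->
  (unfrozen (gsw_step dir x b) \proper unfrozen x)%SET.
Proof.
move=> xc px; have [up uA] := dir_feasible (pivot_unfrozen px).
apply/fintype.properP; split; first exact: gsw_step_sub.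
rewrite (gsw_step_pivot b px).
by have [||] := @step_deltaP x (dir (unfrozen x) p) p b xc;
  rewrite ?up ?oner_eq0.
Qed.

End Step.

(** * The supermartingale *)

Lemma sum_add_at (R : nmodType) (I : finType) (g : I -> R) (p : I) (c : R) :
  \sum_i (g i + (if i == p then c else 0)) = \sum_i g i + c.
Proof. by rewrite big_split -big_mkcond /= big_pred1_eq. Qed.

(** Cauchy-Schwarz for the vectors (sqrt a, sqrt a') and (sqrt b, sqrt b'). *)
Lemma sqr_add_le (R : realFieldType) (a b a' b' f e : R) :
  0 <= a -> 0 <= b -> 0 <= a' -> 0 <= b' -> 0 <= f -> 0 <= e ->
  f ^+ 2 <= a * b -> e ^+ 2 <= a' * b' -> (f + e) ^+ 2 <= (a + a') * (b + b').
Proof.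
move=> a0 b0 a'0 b'0 f0 e0 fab eab.
have h : 2 * (f * e) <= a * b' + a' * b.
  rewrite -ler_sqr ?nnegrE ?addr_ge0 ?mulr_ge0 //.
  have := ler_pM (sqr_ge0 f) (sqr_ge0 e) fab eab.
  have := sqr_ge0 (a * b' - a' * b); nra.
nra.
Qed.

Section Potential.
Context {R : realType} {d n : nat}.
Variables (M : 'M[R]_(d, n)) (v : 'cV[R]_d).
Variable dir : {set 'I_n} -> 'I_n -> 'cV[R]_n.
Hypothesis dirP : direction_rule M dir.
Implicit Types (x y : 'cV[R]_n) (p q i : 'I_n) (b : bool) (A : {set 'I_n}).
Implicit Types (st : 'cV[R]_n * ('I_n -> R)) (f : 'I_n -> R).

Let dir_feasible A p : p \in A -> feasible A p (dir A p).
Proof. by move=> /dirP[]. Qed.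

(** The inner product <M u, v> at a time with unfrozen set A and pivot p. *)
Definition lead A p : R := dot (col p M - span_proj M (A :\ p) *m col p M) v.

(** What a step from x to y adds to the sum of the pivot p: the variation of
    [lead] if p is the pivot at x, and its initial value if the phase of p
    opens at y. *)
Definition increment x y p : R :=
  if pivot x == Some p then `|lead (unfrozen y) p - lead (unfrozen x) p|
  else if pivot y == Some p then `|lead (unfrozen y) p| else 0.

Definition walk_next st b : 'cV[R]_n * ('I_n -> R) :=
  let y := gsw_step dir st.1 b in (y, fun p => st.2 p + increment st.1 y p).

Definition walk_start : 'cV[R]_n * ('I_n -> R) :=
  (0, fun p => if pivot (0 : 'cV[R]_n) == Some p
               then `|lead (unfrozen (0 : 'cV[R]_n)) p| else 0).

(** An index that has not been a pivot yet has an empty sum, and the sum of the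
    current pivot dominates its [lead]. *)
Definition walk_inv st : Prop :=
  [/\ in_cube st.1,
      forall p, pivot st.1 = Some p -> `|lead (unfrozen st.1) p| <= st.2 p &
      forall q, q \in unfrozen st.1 -> pivot st.1 != Some q -> st.2 q = 0].

Lemma walk_inv_initial : walk_inv walk_start.
Proof.
split=> [|p /= ->|q _ /negPf /= -> //]; last by rewrite eqxx.
by apply/forallP => i; rewrite mxE normr0.
Qed.

Lemma walk_inv_next st b : walk_inv st -> walk_inv (walk_next st b).
Proof.
case: st => x f [/= xc xf f0]; have yx := gsw_step_sub dir_feasible x b.
set y := gsw_step dir x b in yx *.
split=> /= [|p py|q qA qy]; first exact: gsw_step_cube.
- rewrite /increment; case: ifPn => [/eqP px|px].
    have := xf p px; set a := lead _ p; set a' := lead _ p => h.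
    by have := ler_normD (a' - a) a; rewrite subrK addrC => /le_trans; apply;
      rewrite lerD2r.
  rewrite py eqxx f0 ?add0r //; apply: (fintype.subsetP yx).
  exact: pivot_unfrozen.
- rewrite /increment (negPf qy); have qAx := fintype.subsetP yx q qA.
  have px : pivot x != Some q by apply: contra qy => /eqP /(pivot_stays yx) ->.
  by rewrite (negPf px) f0 // addr0.
Qed.

(** The factor [coin_mgf] predicts what the rest of the current phase
    contributes if the direction is kept until the pivot is frozen. *)
Definition potential st : R :=
  expR (dot (M *m st.1) v - 2^-1 * \sum_q st.2 q ^+ 2) *
  (if pivot st.1 is Some p then coin_mgf (st.1 p 0) (lead (unfrozen st.1) p)
   else 1).

Lemma in_cubeP x i : in_cube x -> -1 <= x i 0 <= 1.
Proof. by move=> /forallP /(_ i); rewrite ler_norml. Qed.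

(** For each outcome of the coin, freezing indices and changing pivots only
    decreases the potential, compared with the one that keeps the slope a. *)
Lemma potential_outcome st p b (x := st.1) (a := lead (unfrozen x) p)
    (e := step_delta x (dir (unfrozen x) p) b) :
  walk_inv st -> pivot x = Some p ->
  potential (walk_next st b) <=
  expR (dot (M *m x) v - 2^-1 * \sum_q st.2 q ^+ 2) *
   (expR (e * a) * coin_mgf (x p 0 + e) a).
Proof.
move=> inv px; have [xc xf f0] := inv; have [yc _ _] := walk_inv_next b inv.
have yx := gsw_step_sub dir_feasible x b; set f := st.2 in xf f0 *.
have pA := pivot_unfrozen px.
have [up uA] := dir_feasible pA.
have yE := gsw_step_pivot dir b px; rewrite -/x -/e in yE.
have yp : gsw_step dir x b p 0 = x p 0 + e by rewrite yE !mxE up mulr1.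
rewrite /potential /= -/x; set y := gsw_step dir x b in yx yc yE yp *.
have -> : dot (M *m y) v = dot (M *m x) v + e * a.
  rewrite yE mulmxDr -scalemxAr dotDl dotZl; congr (_ + _ * _).
  by rewrite (direction_proj (dirP pA)).
set Z' := \sum_q _; set Z := \sum_q _.
rewrite (_ : _ - _ = (dot (M *m x) v - 2^-1 * Z + e * a)
                     + (2^-1 * Z - 2^-1 * Z')); last by ring.
rewrite (expRD (_ + _)) (expRD _ (e * a)) -!mulrA ler_pM2l ?expR_gt0 //.
rewrite ler_pM2l ?expR_gt0 // -yp.
have ya := xf p px; rewrite -/x -/a in ya.
have yI := in_cubeP p yc.
have incp : increment x y p = `|lead (unfrozen y) p - a|.
  by rewrite /increment px eqxx.
(* First case: the phase of p goes on, possibly with a new slope. *)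
have [py|py] := eqVneq (pivot y) (Some p).
  have -> : Z' = Z + ((f p + `|lead (unfrozen y) p - a|) ^+ 2 - f p ^+ 2).
    rewrite /Z' /Z -(sum_add_at _ p); apply: eq_bigr => q _.
    have [->|qp] := eqVneq q p; first by rewrite incp -/f; ring.
    rewrite /increment px py (_ : Some p == Some q = false) ?addr0 //.
    by apply/negbTE; apply: contraNneq qp => -[->].
  rewrite py; set a' := lead _ _.
  have := @coin_mgf_incr _ (y p 0) a (f p) (a' - a) yI ya.
  rewrite (_ : a + (a' - a) = a'); last by ring.
  move=> h.
  rewrite -(ler_pM2r (expR_gt0 (- (2^-1 * f p ^+ 2)))).
  apply: le_trans h; rewrite mulrAC -expRD mulrC le_eqVlt; apply/orP; left.
  by apply/eqP; congr (_ * expR _); ring.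
(* Second case: p is frozen, and its factor is now 1. *)
have pAy : p \notin unfrozen y by apply: contra py => /(pivot_stays yx px) ->.
have -> : coin_mgf (y p 0) a = 1.
  apply: coin_mgf_end; apply/eqP; rewrite eq_le (forallP yc) /=.
  by rewrite inE -leNgt in pAy.
have f'p : f p ^+ 2 <= (f p + increment x y p) ^+ 2.
  have fp : 0 <= f p by apply: le_trans ya.
  by rewrite ler_sqr ?nnegrE ?addr_ge0 ?incp // lerDl.
case yq: (pivot y) => [q|]; last first.
  rewrite mulr1 -[leRHS]expR0 ler_expR -mulrBr pmulr_rle0 ?invr_gt0 // subr_le0.
  apply: ler_sum => i _; have [-> //|ip] := eqVneq i p.
  rewrite /increment px yq (_ : Some p == Some i = false) ?addr0 //.
  by apply/negbTE; apply: contraNneq ip => -[->].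
have qA := pivot_unfrozen yq.
have qp : q != p by apply: contraTneq qA => ->.
have fq : f q = 0.
  apply: f0; first exact: (fintype.subsetP yx).
  by rewrite px; apply: contra qp => /eqP [->].
set c := lead _ _.
apply: le_trans (coin_mgf_le c (in_cubeP q yc)).
rewrite mulrC ler_wpM2l //.
  exact/coin_mgf_ge0/in_cubeP.
rewrite ler_expR -mulrBr -mulrN ler_wpM2l ?invr_ge0 //.
rewrite lerBlDl -lerBlDr opprK -(sum_add_at _ q); apply: ler_sum => i _.
have [->|iq] := eqVneq i q.
  rewrite -/f fq /increment px yq eqxx add0r expr0n /= add0r.
  by rewrite (inj_eq Some_inj) eq_sym (negPf qp).
rewrite addr0; have [-> //|ip] := eqVneq i p.
by rewrite /increment px yq !(inj_eq Some_inj) !(eq_sym _ i) (negPf ip)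
  (negPf iq) addr0.
Qed.

Lemma potential_step st : walk_inv st ->
  \sum_b coin_prob dir st.1 b * potential (walk_next st b) <= potential st.
Proof.
move=> inv; case px: (pivot st.1) => [p|]; last first.
  have nextE b : potential (walk_next st b) = potential st.
    rewrite /potential /walk_next /= gsw_step_None //;
      congr (expR (_ - _ * _) * _).
    by apply: eq_bigr => q _; rewrite /increment px addr0.
  under eq_bigr do rewrite nextE /coin_prob px.
  rewrite big_bool -[leLHS]/(_ + _) -mulrDl.
  have half2 : 2^-1 + 2^-1 = 1 :> R by field.
  by rewrite half2 mul1r.
have [xc _ _] := inv; have [up uA] := dir_feasible (pivot_unfrozen px).
rewrite big_bool -[leLHS]/(_ + _) /coin_prob px; set x := st.1 in px xc *;
  set u := dir _ _ in up uA *.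
have u0 : u p 0 != 0 by rewrite up oner_eq0.
have [s0 _ _] := step_deltaP true xc u0 uA.
have [t0 _ _] := step_deltaP false xc u0 uA.
set s := delta_plus x u in s0 *; set t := delta_minus x u in t0 *.
have ht := potential_outcome true inv px;
  have hf := potential_outcome false inv px.
rewrite {3}/potential px.
rewrite -(coin_mgf_martingale (x p 0) (lead (unfrozen x) p) (addr_gt0 s0 t0)).
rewrite mulrDr [X in _ <= X + _]mulrCA [X in _ <= _ + X]mulrCA.
by apply: lerD; apply: ler_wpM2l => //; rewrite divr_ge0 ?addr_ge0 // ltW.
Qed.

Lemma potential_initial : potential walk_start <= 1.
Proof.
rewrite /potential /= mulmx0 dot0l sub0r.
have x0 i : -1 <= (0 : 'cV[R]_n) i 0 <= 1 by rewrite mxE; lra.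
case px: (pivot _) => [p|].
  rewrite (_ : \sum_q _ = `|lead (unfrozen (0 : 'cV[R]_n)) p| ^+ 2).
    by rewrite mulrC; apply: coin_mgf_le.
  rewrite (bigD1 p) //= eqxx big1 ?addr0 // => q qp.
  by rewrite (inj_eq Some_inj) eq_sym (negPf qp) expr0n.
by rewrite big1 ?mulr0 ?oppr0 ?expR0 ?mulr1 // => q _; rewrite expr0n.
Qed.

(** * The energy bound *)

(** Here e is the energy lost by v since the start of the phase of p. In the
    second condition it is multiplied by the energy lost by v_p. *)
Definition energy_inv st : Prop :=
  let x := st.1 in let f := st.2 in
  if pivot x is Some p then
    let P := span_proj M (unfrozen x :\ p) in
    exists e : R, [/\ 0 <= e,
      f p ^+ 2 <= (dot (col p M) (col p M) - dot (P *m col p M) (col p M)) * e &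
      \sum_(q | q != p) f q ^+ 2 + e + dot (P *m v) v <= dot v v]
  else \sum_q f q ^+ 2 <= dot v v.

Lemma span_proj_diff_ge0 A A' (z : 'cV[R]_d) : A' \subset A ->
  0 <= dot (span_proj M A *m z) z - dot (span_proj M A' *m z) z.
Proof.
move=> /(col_spanS M) AA; rewrite -dotBl.
by rewrite (dot_orth_projB z z AA) dot_ge0.
Qed.

Lemma lead_start A p : p \in A ->
  lead A p ^+ 2 <=
  (dot (col p M) (col p M) - dot (span_proj M (A :\ p) *m col p M) (col p M)) *
  (dot (span_proj M A *m v) v - dot (span_proj M (A :\ p) *m v) v).
Proof.
move=> pA; have AA := col_spanS M (subsetDl A [set p]%SET).
have := orth_projB_Cauchy_Schwarz (col p M) v AA.
by rewrite (orth_proj_id (col_span_mem M pA)) /lead !dotBl.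
Qed.

Lemma lead_increment A A' p : A' \subset A ->
  (lead A' p - lead A p) ^+ 2 <=
  (dot (span_proj M (A :\ p) *m col p M) (col p M)
   - dot (span_proj M (A' :\ p) *m col p M) (col p M)) *
  (dot (span_proj M (A :\ p) *m v) v - dot (span_proj M (A' :\ p) *m v) v).
Proof.
move=> AA; have sub := col_spanS M (finset.setSD [set p]%SET AA).
have -> : lead A' p - lead A p =
    dot (span_proj M (A :\ p) *m col p M - span_proj M (A' :\ p) *m col p M) v.
  by rewrite /lead !dotBl; ring.
by rewrite -!dotBl; apply: (orth_projB_Cauchy_Schwarz (col p M) v sub).
Qed.

(** At the start of a phase with pivot p, the energy lost by v is that of
    passing from A to A - p, while v_p, which belongs to the span over A, loses
    the energy of its residual. *)
Lemma energy_enter y f g :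
  (forall p, pivot y = Some p -> f p = 0) ->
  (forall p, g p = f p +
    if pivot y == Some p then `|lead (unfrozen y) p| else 0) ->
  \sum_q f q ^+ 2 + dot (span_proj M (unfrozen y) *m v) v <= dot v v ->
  energy_inv (y, g).
Proof.
move=> fp0 gE hf; rewrite /energy_inv /=; case yp: (pivot y) => [p|];
  last first.
  apply: le_trans hf; rewrite -[leLHS]addr0; apply: lerD.
    by apply: ler_sum => q _; rewrite gE yp addr0.
  by rewrite -dot_orth_proj2 dot_ge0.
have pA := pivot_unfrozen yp.
exists (dot (span_proj M (unfrozen y) *m v) v
        - dot (span_proj M (unfrozen y :\ p) *m v) v).
split; first exact/span_proj_diff_ge0/subsetDl.
  by rewrite gE fp0 // yp eqxx add0r real_normK ?num_real // lead_start.
rewrite -addrA subrK; apply: le_trans hf; rewrite lerD2r.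
rewrite [leRHS](bigD1 p) //= fp0 // expr0n add0r; apply: ler_sum => q qp.
by rewrite gE yp (inj_eq Some_inj) eq_sym (negPf qp) addr0.
Qed.

Lemma energy_initial : energy_inv walk_start.
Proof.
apply: (@energy_enter _ (fun=> 0)) => // [p|]; first by rewrite add0r.
by rewrite big1 ?add0r ?orth_proj_contract // => q _; rewrite expr0n.
Qed.

(** When the phase of p closes, v_p has lost at most its whole energy, which is
    at most 1, and the accumulated f_p^2 can be charged to v alone. *)
Lemma energy_next st b : (forall i, norm2 (col i M) <= 1) ->
  walk_inv st -> energy_inv st -> energy_inv (walk_next st b).
Proof.
move=> colM; case: st => x f inv; have [xc xf f0] := inv;
  rewrite /= in xc xf f0.
have yx := gsw_step_sub dir_feasible x b.
rewrite {1}/energy_inv /=; case px: (pivot x) => [p|]; last first.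
  move=> fv; rewrite /energy_inv /walk_next /= gsw_step_None // px.
  by under eq_bigr do rewrite /increment px addr0.
move=> [e [e0 fpe fv]]; rewrite /walk_next /=;
  set y := gsw_step dir x b in yx *.
set c := lead (unfrozen y) p - lead (unfrozen x) p.
have fp0 : 0 <= f p by apply: le_trans (xf p px).
have incE i : increment x y i = if i == p then `|c| else
    if pivot y == Some i then `|lead (unfrozen y) i| else 0.
  by rewrite /increment px (inj_eq Some_inj) eq_sym; case: eqVneq => // ->.
have AyAx := finset.setSD [set p]%SET yx.
have := span_proj_diff_ge0 v AyAx; have := span_proj_diff_ge0 (col p M) AyAx.
have := lead_increment p yx; rewrite -/c -(real_normK (num_real c)).
have := orth_proj_contract (col_span M (unfrozen x :\ p)) (col p M).
rewrite -/(span_proj _ _); set a1 := dot (col p M) _; set a2 := dot _ (col p M).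
set a3 := dot _ (col p M); set e1 := dot _ v; set e2 := dot _ v.
move=> a12 cae a23 e12.
have step : (f p + `|c|) ^+ 2 <= (a1 - a3) * (e + (e1 - e2)).
  rewrite (_ : a1 - a3 = a1 - a2 + (a2 - a3)); last by ring.
  by apply: sqr_add_le => //; rewrite subr_ge0.
have [yp|yp] := eqVneq (pivot y) (Some p).
  rewrite /energy_inv /= yp; exists (e + (e1 - e2)); split.
  - exact: addr_ge0.
  - by rewrite incE eqxx.
  - rewrite (eq_bigr (fun q => f q ^+ 2));
      first by move: fv; rewrite -/e1 -/e2; lra.
    move=> q /negPf qp.
    by rewrite incE qp yp (inj_eq Some_inj) eq_sym qp addr0.
have pAy : p \notin unfrozen y by apply: contra yp => /(pivot_stays yx px) ->.
apply: (@energy_enter _ (fun i => f i + if i == p then `|c| else 0)).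
- move=> q yq; have qA := pivot_unfrozen yq.
  have qp : q != p by apply: contraTneq qA => ->.
  rewrite (negPf qp) addr0 f0 //; first exact: (fintype.subsetP yx).
  by rewrite px (inj_eq Some_inj) eq_sym.
- move=> i; rewrite incE -addrA; case: eqVneq => [->|]; last by rewrite add0r.
  by rewrite (negPf yp) addr0.
(* p is frozen, so the phase ends with the span over all of [unfrozen y]. *)
have Ay : unfrozen y :\ p = unfrozen y.
  by apply/finset.setDidPl; rewrite disjoint_sym disjoints1.
rewrite (bigD1 p) //= eqxx (eq_bigr (fun q => f q ^+ 2)); last first.
  by move=> q /negPf ->; rewrite addr0.
have fe : (f p + `|c|) ^+ 2 <= e + (e1 - e2).
  apply: le_trans step _; rewrite -[leRHS]mul1r ler_wpM2r ?(addr_ge0 e0 e12) //.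
  have a30 : 0 <= a3 by rewrite /a3 -dot_orth_proj2 dot_ge0.
  have a11 : a1 <= 1 by rewrite /a1 -norm2_sqr expr_le1 ?sqrtr_ge0.
  lra.
by move: fv fe; rewrite /e2 Ay -/e1; lra.
Qed.

End Potential.

(** * Times and pivots of a run *)

Section Run.
Context {R : realType} {n : nat}.
Variable dir : {set 'I_n} -> 'I_n -> 'cV[R]_n.
Hypothesis dir_feasible : forall (A : {set 'I_n}) p,
  p \in A -> feasible A p (dir A p).
Variable c : n.-tuple bool.
Implicit Types (p q i r : 'I_n) (s t k : nat).

Local Notation X := (gsw_X dir c).
Local Notation A := (gsw_A dir c).
Local Notation piv := (gsw_pivot dir c).
Local Notation T := (gsw_T dir c).

Lemma gsw_XS k : (k < n)%N -> X k.+2 = gsw_step dir (X k.+1) (nth false c k).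
Proof.
move=> kn; rewrite /gsw_X /= (take_nth false) ?size_tuple //.
by rewrite -cats1 foldl_cat.
Qed.

Lemma gsw_X_stop k : (n <= k)%N -> X k.+1 = X n.+1.
Proof. by move=> nk; rewrite /gsw_X /= !take_oversize ?size_tuple. Qed.

Lemma gsw_X_cube t : in_cube (X t).
Proof.
case: t => [|k]; first by apply/forallP => i; rewrite /gsw_X take0 mxE normr0.
elim: k => [|k IH]; first by apply/forallP => i;
  rewrite /gsw_X take0 mxE normr0.
have [kn|nk] := ltnP k n; first by rewrite gsw_XS // gsw_step_cube.
by rewrite gsw_X_stop ?(leq_trans nk) // -(gsw_X_stop nk).
Qed.

Lemma gsw_A_anti s t : (s <= t)%N -> A t \subset A s.
Proof.
move=> /subnK <-; elim: (t - s)%N => [|k IH] //; apply: fintype.subset_trans IH.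
rewrite addSn; case: (k + s)%N => [|m]; first by rewrite /gsw_A /gsw_X /=.
have [mn|nm] := ltnP m n; first by rewrite /gsw_A gsw_XS // gsw_step_sub.
by rewrite /gsw_A !gsw_X_stop ?(leq_trans nm).
Qed.

(** Every step freezes an index, so that n coins suffice to end the walk. *)
Lemma card_gsw_A k : (k <= n)%N -> (#|A k.+1| <= n - k)%N.
Proof.
elim: k => [|k IH] kn; first by rewrite subn0 -[leqRHS]card_ord max_card.
have := IH (ltnW kn); case pk: (piv k.+1) => [p|].
  have := proper_card (gsw_step_proper dir_feasible (nth false c k)
    (gsw_X_cube _) pk).
  by rewrite -gsw_XS // -!/(gsw_A _ _ _); lia.
move/pivot_None: pk => pk _; have := gsw_A_anti (leqnSn k.+1).
by rewrite {2}/gsw_A pk finset.subset0 => /eqP ->; rewrite cards0.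
Qed.

Lemma gsw_T_le : (T <= n)%N.
Proof. by rewrite -[leqRHS](size_iota 0) find_size. Qed.

Lemma gsw_A_T : A T.+1 = finset.set0.
Proof.
have [Tn|nT] := ltnP T n.
  have h : has (fun k => A k.+1 == finset.set0) (iota 0 n).
    by rewrite has_find size_iota.
  have := nth_find 0%N h; rewrite nth_iota ?add0n; last by [].
  by move=> /eqP.
have -> : T = n by apply/eqP; rewrite eqn_leq gsw_T_le.
by apply/eqP; rewrite -cards_eq0 -leqn0; have := card_gsw_A (leqnn n);
  rewrite subnn.
Qed.

Lemma gsw_pivot_T t p : piv t = Some p -> (t <= T)%N.
Proof.
move=> pt; rewrite leqNgt; apply/negP => /gsw_A_anti.
by rewrite gsw_A_T => /fintype.subsetP /(_ p (pivot_unfrozen pt)); rewrite inE.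
Qed.

Lemma gsw_pivot_Some t : (0 < t <= T)%N -> exists p, piv t = Some p.
Proof.
case: t => // k /= kT; case pk: (piv k.+1) => [p|]; first by exists p.
have /(before_find 0%N) : (k < T)%N by [].
rewrite nth_iota ?add0n ?(leq_trans kT) ?gsw_T_le //.
by move/pivot_None: pk => /eqP; rewrite -/(gsw_A _ _ _) => ->.
Qed.

Lemma gsw_X_after_T t : (T < t)%N -> X t = X T.+1.
Proof.
move=> /subnK <-; elim: (t - _)%N => [|k IH] //; rewrite addSn addnS.
have [kn|nk] := ltnP (k + T) n.
  rewrite gsw_XS // -addnS IH gsw_step_None //; apply/pivot_None.
  exact: gsw_A_T.
by rewrite gsw_X_stop ?(leq_trans nk) // -(gsw_X_stop nk) -addnS.
Qed.

Lemma gsw_outputE : gsw_output dir c = X n.+1.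
Proof. by rewrite /gsw_output gsw_X_after_T // ltnS gsw_T_le. Qed.

Lemma gsw_pivot_stays s t p : (s <= t)%N -> piv s = Some p -> p \in A t ->
  piv t = Some p.
Proof. by move=> st; apply/pivot_stays/gsw_A_anti. Qed.

Lemma mem_phase p t :
  (t \in pivot_phase dir c p) = (0 < t)%N && (piv t == Some p).
Proof.
rewrite mem_filter mem_iota add1n ltnS andbC; case: (0 < t)%N => //=.
by case: eqVneq => [/gsw_pivot_T ->|_]; rewrite ?andbF.
Qed.

Lemma pivot_startP p t : (0 < t)%N -> piv t = Some p ->
  [/\ (0 < pivot_start dir c p)%N, (pivot_start dir c p <= t)%N
    & piv (pivot_start dir c p) = Some p].
Proof.
move=> t0 pt; have : t \in pivot_phase dir c p by rewrite mem_phase t0 pt eqxx.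
have sorted_phase : sorted leq (pivot_phase dir c p).
  exact/sorted_filter/iota_sorted/leq_trans.
rewrite /pivot_start; case E: (pivot_phase dir c p) sorted_phase
  => [//|s l] /= ls tl.
have : s \in pivot_phase dir c p by rewrite E mem_head.
rewrite mem_phase => /andP[s0 /eqP ps]; split => //.
move: tl; rewrite inE => /predU1P[-> //|]; apply/allP.
by move: ls; rewrite (path_sortedE leq_trans) => /andP[].
Qed.

(** A pivot stays the pivot until it is frozen, so that its phase is an
    interval of times and it starts where the previous pivot is different. *)
Lemma pivot_start_eq p t : (0 < t)%N -> piv t = Some p ->
  (pivot_start dir c p == t) = (t == 1%N) || (piv t.-1 != Some p).
Proof.
move=> t0 pt; have [s0 st ps] := pivot_startP t0 pt.
have [t1|t1] := eqVneq t 1%N; first by rewrite t1 /=; apply/eqP; lia.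
apply/eqP/negP => [st' /eqP pt'|pt'].
  by have [|_ + _] := pivot_startP _ pt'; lia.
apply/eqP/negPn/negP => st'; case: pt'; apply/eqP.
apply: (@gsw_pivot_stays (pivot_start dir c p)) => //; first by move: st st';
  lia.
apply: (fintype.subsetP (gsw_A_anti (leq_pred t))); exact: pivot_unfrozen pt.
Qed.

Lemma mem_pivots p t : (0 < t)%N -> piv t = Some p -> p \in pivots dir c.
Proof.
move=> t0 pt; rewrite inE; have : t \in pivot_phase dir c p.
  by rewrite mem_phase t0 pt eqxx.
by case: (pivot_phase dir c p).
Qed.

Lemma pivotsP p : p \in pivots dir c -> exists2 t, (0 < t)%N & piv t = Some p.
Proof.
rewrite inE; case E: (pivot_phase dir c p) => [//|s l] _.
have : s \in pivot_phase dir c p by rewrite E mem_head.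
by rewrite mem_phase => /andP[s0 /eqP ps]; exists s.
Qed.

(** * The order of the indices *)

Definition listed_upto k : seq 'I_n :=
  flatten [seq listed_at dir c t | t <- iota 1 k].

Lemma listed_uptoS k : listed_upto k.+1 = listed_upto k ++ listed_at dir c k.+1.
Proof.
rewrite /listed_upto -[in LHS](addn1 k) iotaD map_cat flatten_cat /=.
by rewrite cats0 add1n.
Qed.

(** The times t of the walk start at 1; there is no pivot before the first
    step, although [gsw_X] takes the same value at 0 and at 1. *)
Definition old_pivot k i : bool := (0 < k)%N && (piv k == Some i).

Definition new_pivot_seq t p : seq 'I_n :=
  if pivot_start dir c p == t then [:: p] else [::].

Lemma listed_at_pivot k p : piv k.+1 = Some p ->
  listed_at dir c k.+1 =
  new_pivot_seq k.+1 p ++ rev (enum (gsw_frozen dir c k.+1 :\ p)%SET).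
Proof. by rewrite /listed_at => ->. Qed.

Lemma mem_new_pivot k p i : piv k.+1 = Some p ->
  (i \in new_pivot_seq k.+1 p) = (i == p) && ~~ old_pivot k p.
Proof.
move=> pk; rewrite /new_pivot_seq pivot_start_eq //= /old_pivot.
by case: k {pk} => [|k] /=; rewrite ?inE ?andbT //; case: ifP;
  rewrite ?inE ?andbT ?andbF.
Qed.

Lemma old_pivot_stays k p i : piv k.+1 = Some p -> old_pivot k i ->
  i \in A k.+1 -> i = p.
Proof.
move=> pk /andP[_ /eqP pi] iA.
by have := gsw_pivot_stays (leqnSn k) pi iA; rewrite pk => -[].
Qed.

(** The pivot of step k is listed while it may still be unfrozen; the induction
    keeps track of it, because step k + 1 lists its own pivot only if it is a
    different one. *)
Lemma listed_uptoP k : (k <= T)%N ->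
  uniq (listed_upto k) /\
  forall i, (i \in listed_upto k) = (i \notin A k.+1) || old_pivot k i.
Proof.
elim: k => [_|k IH kT].
  by split=> // i; rewrite !inE /= orbF /gsw_X take0 mxE normr0 ltr01.
have [u mem] := IH (ltnW kT); have [p pk] : exists p, piv k.+1 = Some p.
  by apply: gsw_pivot_Some.
have pA := pivot_unfrozen pk; have A'A := gsw_A_anti (leqnSn k.+1).
rewrite listed_uptoS (listed_at_pivot pk); split=> [|i].
  rewrite catA !cat_uniq rev_uniq enum_uniq u /= andbT -andbA; apply/and3P;
    split.
  - apply/hasPn => i; rewrite mem_new_pivot // => /andP[/eqP -> op] /=.
    by rewrite mem (negPf op) orbF negbK.
  - by rewrite /new_pivot_seq; case: ifP.
  - apply/hasPn => i; rewrite mem_rev mem_enum in_setD1 /gsw_frozen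
      finset.in_setD => /and3P[ip _ iA].
    rewrite /= mem_cat mem_new_pivot // (negPf ip) orbF mem iA /=.
    by apply: contra ip => /(old_pivot_stays pk) ->.
rewrite !mem_cat mem_new_pivot // mem_rev mem_enum mem in_setD1 finset.in_setD
  /old_pivot /= pk.
rewrite (inj_eq Some_inj) (eq_sym p).
have [->|ip] /= := eqVneq i p; first by rewrite pA /= orbT; case: (_ && _).
rewrite orbF; have [iA'|iA'] /= := boolP (i \in A k.+2).
  have iA := fintype.subsetP A'A i iA'; rewrite iA /= orbF.
  by apply: contraNF ip => /(old_pivot_stays pk) ->.
by case: (i \in A k.+1); rewrite ?orbT.
Qed.

Lemma gsw_order_uniq : uniq (gsw_order dir c).
Proof. by have [] := listed_uptoP (leqnn T). Qed.

Lemma mem_gsw_order i : i \in gsw_order dir c.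
Proof. by have [_ ->] := listed_uptoP (leqnn T); rewrite gsw_A_T inE. Qed.

Lemma size_gsw_order : size (gsw_order dir c) = n.
Proof.
rewrite -(card_uniqP gsw_order_uniq) -[RHS]card_ord; apply: eq_card => i.
by rewrite mem_gsw_order.
Qed.

Lemma gsw_sigma_inj : injective (gsw_sigma dir c).
Proof.
have sz r : (r < size (rev (gsw_order dir c)))%N.
  by rewrite size_rev size_gsw_order.
move=> r r'; rewrite /gsw_sigma (set_nth_default r') // => /eqP.
by rewrite nth_uniq ?rev_uniq ?gsw_order_uniq // => /eqP/val_inj.
Qed.

(** As sigma enumerates the reverse of the list, these are the sets
    {sigma(1), ..., sigma(k)}. *)
Definition listed_last (S : {set 'I_n}) : Prop :=
  exists pre post, gsw_order dir c = pre ++ post /\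
    forall i, (i \in pre) = (i \notin S).

Lemma listed_last_sigma S : listed_last S ->
  exists2 k, (k <= n)%N & forall r, (gsw_sigma dir c r \in S) = (r < k)%N.
Proof.
move=> [pre [post [E mem]]]; have := size_gsw_order.
rewrite E size_cat => sz; have := gsw_order_uniq.
rewrite {1}E cat_uniq => /and3P[_ /hasPn dj _].
exists (size post); first by move: sz; lia.
move=> r; rewrite /gsw_sigma E rev_cat nth_cat size_rev; case: ltnP => h.
  have : nth r (rev post) r \in post by rewrite -mem_rev mem_nth // size_rev.
  by move=> /dj; rewrite /= mem negbK.
apply/negbTE; rewrite -mem -mem_rev mem_nth // size_rev.
by rewrite ltn_subLR // [X in (_ < X)%N]addnC sz ltn_ord.
Qed.

Lemma gsw_order_cat k : (k <= T)%N ->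
  gsw_order dir c =
  listed_upto k ++ flatten [seq listed_at dir c t | t <- iota k.+1 (T - k)].
Proof.
by move=> kT; rewrite /gsw_order -{1}(subnKC kT) iotaD map_cat flatten_cat.
Qed.

Lemma listed_last_after k p : (0 < k)%N -> piv k = Some p ->
  listed_last (A k.+1 :\ p).
Proof.
move=> k0 pk; have kT := gsw_pivot_T pk.
exists (listed_upto k); eexists; split; first exact: gsw_order_cat.
move=> i; have [_ ->] := listed_uptoP kT.
by rewrite in_setD1 negb_and negbK orbC /old_pivot k0 pk (inj_eq Some_inj)
  eq_sym.
Qed.

Lemma listed_last_start k p : piv k.+1 = Some p -> ~~ old_pivot k p ->
  listed_last (A k.+1).
Proof.
move=> pk op; have kT := gsw_pivot_T pk.
exists (listed_upto k); eexists; split; first exact: gsw_order_cat (ltnW kT).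
move=> i; have [_ ->] := listed_uptoP (ltnW kT).
have [iA|//] /= := boolP (i \in A k.+1).
by apply: contraNF op => oi; rewrite -(old_pivot_stays pk oi iA).
Qed.

Lemma listed_last_before k p : piv k.+1 = Some p -> listed_last (A k.+1 :\ p).
Proof.
move=> pk; have kT := gsw_pivot_T pk; have [_ mem] := listed_uptoP (ltnW kT).
exists (listed_upto k ++ new_pivot_seq k.+1 p); eexists; split.
  rewrite (gsw_order_cat kT) listed_uptoS (listed_at_pivot pk) -!catA.
  by congr (_ ++ (_ ++ _)).
move=> i; rewrite mem_cat mem mem_new_pivot // in_setD1 negb_and negbK.
have [->|ip] /= := eqVneq i p.
  by rewrite (pivot_unfrozen pk) /=; case: old_pivot.
rewrite orbF; have [iA|//] /= := boolP (i \in A k.+1).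
by apply: contraNF ip => /(old_pivot_stays pk) ->.
Qed.

End Run.

(** * Blocks of Gram-Schmidt vectors *)

Section ZLink.
Context {R : realType} {d n : nat}.
Variables (M : 'M[R]_(d, n)) (v : 'cV[R]_d).
Variable dir : {set 'I_n} -> 'I_n -> 'cV[R]_n.
Hypothesis dir_feasible : forall (A : {set 'I_n}) p,
  p \in A -> feasible A p (dir A p).
Variable c : n.-tuple bool.
Implicit Types (p q i r : 'I_n) (s t k : nat) (S : {set 'I_n}) (x y : 'cV[R]_d).

Local Notation X := (gsw_X dir c).
Local Notation A := (gsw_A dir c).
Local Notation piv := (gsw_pivot dir c).
Local Notation sigma := (gsw_sigma dir c).
Local Notation w := (gsw_w dir c M).

Lemma gsw_projE r :
  gsw_proj dir c M r =
  span_proj M [set sigma k | k in [set k : 'I_n | (k < r)%N]]%SET.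
Proof.
rewrite /gsw_proj /span_proj /col_span; congr orth_proj.
rewrite big_imset /=; last by move=> ? ? _ _; apply: gsw_sigma_inj.
by apply: eq_bigl => k; rewrite inE.
Qed.

(** The vectors w are an orthonormal family, up to null vectors, adapted to the
    flag of spans; this expresses it without mentioning orthogonality. *)
Lemma span_proj_sum_w k x : (k <= n)%N ->
  span_proj M [set sigma r | r in [set r : 'I_n | (r < k)%N]]%SET *m x =
  \sum_(r < n | (r < k)%N) dot (w r) x *: w r.
Proof.
elim: k => [_|k IH kn].
  rewrite big_pred0 //; apply: span_proj_uniq; first by rewrite trmx0 sub0mx.
  by move=> i /imsetP[r]; rewrite inE.
pose r0 := Ordinal kn.
have -> : [set sigma r | r in [set r : 'I_n | (r < k.+1)%N]]%SET =
    sigma r0 |: [set sigma r | r in [set r : 'I_n | (r < k)%N]]%SET.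
  have -> : [set r : 'I_n | (r < k.+1)%N]%SET =
      r0 |: [set r : 'I_n | (r < k)%N]%SET.
    by apply/finset.setP => r; rewrite !inE ltnS leq_eqVlt.
  by rewrite imsetU1.
rewrite span_proj_add1 IH ?(ltnW kn) // [RHS](bigD1 r0) //= addrC.
congr (_ + _); last by rewrite /gsw_w gsw_projE.
by apply: eq_bigl => r; rewrite ltnS andbC ltn_neqAle.
Qed.

Lemma sum_w_listed_last S x y : listed_last dir c S ->
  \sum_(r | sigma r \in S) dot (w r) x * dot (w r) y =
  dot (span_proj M S *m x) y.
Proof.
move=> /(listed_last_sigma dir_feasible)[k kn Sk].
have -> : S = [set sigma r | r in [set r : 'I_n | (r < k)%N]]%SET.
  apply/finset.setP => i.
  have [tau _ sigmaK] := injF_bij (gsw_sigma_inj (c := c) dir_feasible).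
  apply/idP/imsetP => [iS|[r rk ->]]; last by rewrite Sk inE in rk *.
  by exists (tau i); rewrite ?inE -?Sk sigmaK.
rewrite span_proj_sum_w //.
rewrite (big_morph (fun z => dot z y) (fun a b => dotDl a b y) (dot0l y)).
rewrite (eq_bigl (fun r : 'I_n => (r < k)%N)).
  by apply: eq_bigr => r _; rewrite dotZl.
move=> r; apply/imsetP/idP => [[r']|rk]; last by exists r; rewrite ?inE.
by rewrite inE => r'k /(gsw_sigma_inj dir_feasible) ->.
Qed.

Lemma sum_w_diff S S' x y : listed_last dir c S -> listed_last dir c S' ->
  S' \subset S ->
  \sum_(r | (sigma r \in S) && (sigma r \notin S')) dot (w r) x * dot (w r) y =
  dot (span_proj M S *m x) y - dot (span_proj M S' *m x) y.
Proof.
move=> lS lS' /fintype.subsetP SS.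
rewrite -!sum_w_listed_last //.
rewrite [X in _ = X - _](bigID (fun r => sigma r \in S')) /=.
rewrite [X in _ = X + _ - _](eq_bigl (fun r => sigma r \in S')); last first.
  by move=> r; apply: andb_idl => /SS.
by rewrite addrAC subrr add0r.
Qed.

(** The term s = 0 stands for the phase of the very first pivot, which has no
    step before it. *)
Definition phase_term p s : R :=
  if s is 0%N then (if piv 1 == Some p then `|lead M v (A 1) p| else 0)
  else increment M v (X s) (X s.+1) p.

Lemma phase_term0 p s : (forall t, (0 < t <= s.+1)%N -> piv t != Some p) ->
  phase_term p s = 0.
Proof.
move=> h; case: s h => [|s] h /=; first by rewrite (negPf (h 1%N _)).
by rewrite /increment (negPf (h s.+1 _)) ?leqnSn // (negPf (h s.+2 _)) ?leqnn.
Qed.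

(** For s = t_p - 1 the block is the passage from A to A - p at the start of
    the phase, and for a step s of the phase it is the passage from the set
    A - p at time s to the one at time s + 1. *)
Lemma sum_gsw_Q p s : p \in pivots dir c -> ((pivot_start dir c p).-1 <= s)%N ->
  `|\sum_(r in gsw_Q dir c p s) dot (w r) (col p M) * dot (w r) v| =
  phase_term p s.
Proof.
move=> /(pivotsP dir_feasible)[t0 t00 pt0] ss.
have [st0 _ pst] := pivot_startP dir_feasible t00 pt0.
rewrite /gsw_Q; have [sE|sn] := eqVneq s (pivot_start dir c p).-1.
  have stE : pivot_start dir c p = s.+1 by move: st0 sE; lia.
  have ps : piv s.+1 = Some p by rewrite -stE.
  have op : ~~ old_pivot dir c s p.
    have := pivot_start_eq dir_feasible (ltn0Sn s) ps;
      rewrite stE eqxx => /esym.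
    by rewrite /old_pivot; case: (s).
  have pA := pivot_unfrozen ps.
  have QE : \sum_(r in [set r | sigma r == p]%SET)
      dot (w r) (col p M) * dot (w r) v = lead M v (A s.+1) p.
    rewrite (eq_bigl (fun r => (sigma r \in A s.+1) &&
                               (sigma r \notin A s.+1 :\ p))).
      rewrite sum_w_diff ?subD1set //; first last.
      - exact: (listed_last_before dir_feasible ps).
      - exact: (listed_last_start dir_feasible ps op).
      - by rewrite (orth_proj_id (col_span_mem M pA)) -dotBl.
    move=> r; rewrite in_setD1 inE negb_and negbK.
    by have [->|] := eqVneq (sigma r) p; rewrite ?pA //= andbN.
  rewrite QE; case: (s) ps op => [|k] /= ps op; first by rewrite ps eqxx.
  move: op; rewrite /old_pivot /= /increment => /negPf ->.
  by rewrite -/(gsw_pivot dir c k.+2) ps eqxx.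
have [sp|sp] := boolP (s \in pivot_phase dir c p).
  move: sp; rewrite mem_phase // => /andP[s0 /eqP ps].
  case: s s0 ps ss sn => // k _ pk ss sn.
  rewrite /phase_term /increment -/(gsw_pivot dir c k.+1) pk eqxx.
  rewrite (eq_bigl (fun r => (sigma r \in A k.+1 :\ p) &&
                             (sigma r \notin A k.+2 :\ p))).
    rewrite sum_w_diff.
    - by congr `|_|; rewrite /gsw_A /lead !dotBl; ring.
    - exact: (listed_last_before dir_feasible pk).
    - exact: (listed_last_after dir_feasible (ltn0Sn k) pk).
    - exact/finset.setSD/gsw_A_anti.
  move=> r; rewrite inE !in_setD1 /gsw_frozen finset.in_setD.
  by case: (sigma r == p); rewrite //= andbC.
rewrite big_pred0 ?normr0; last by move=> r; rewrite inE.
apply/esym; case: s ss sn sp => [|k] ss sn sp /=.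
  case: eqP => // p1; have := pivot_start_eq dir_feasible (ltn0Sn 0) p1.
  by rewrite eqxx => /eqP h; rewrite h in sn.
move: sp; rewrite mem_phase //= => /negPf pk.
rewrite /increment -/(gsw_pivot dir c k.+1) pk; case: eqP => // pk2.
have := pivot_start_eq dir_feasible (ltn0Sn k.+1) pk2; rewrite /= /gsw_pivot pk.
by move=> /eqP h; rewrite h eqxx in sn.
Qed.

Lemma gsw_ZE :
  gsw_Z dir c M v = \sum_p (\sum_(0 <= s < n.+1) phase_term p s) ^+ 2.
Proof.
rewrite /gsw_Z [RHS](bigID [in pivots dir c]) /= [X in _ + X]big1 ?addr0;
  last first.
  move=> p pP; rewrite big1 ?expr0n // => s _;
    apply: phase_term0 => t /andP[t0 _].
  by apply: contra pP => /eqP /(mem_pivots dir_feasible t0).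
apply: eq_bigr => p pP; congr (_ ^+ 2).
have [t t0 pt] := pivotsP dir_feasible pP.
have [s0 st _] := pivot_startP dir_feasible t0 pt.
have tT := gsw_pivot_T dir_feasible pt; have Tn := gsw_T_le dir c.
rewrite [RHS](@big_cat_nat _ _ _ (pivot_start dir c p).-1) //=; last by lia.
rewrite [X in X + _]big_nat_cond [X in X + _]big1 ?add0r.
  by apply: eq_big_nat => s /andP[ss _]; apply: sum_gsw_Q.
move=> s /andP[/andP[_ ss] _]; apply: phase_term0 => u /andP[u0 us];
  apply/eqP => pu.
have [_ + _] := pivot_startP dir_feasible u0 pu; lia.
Qed.

Lemma run_state k : (k <= n)%N ->
  (foldl (walk_next M v dir) (walk_start M v) (take k c)).1 = X k.+1 /\
  forall p, (foldl (walk_next M v dir) (walk_start M v) (take k c)).2 p =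
    \sum_(0 <= s < k.+1) phase_term p s.
Proof.
elim: k => [_|k IH kn].
  rewrite take0 /=; split; first by rewrite /gsw_X take0.
  by move=> p; rewrite big_nat1 /= /gsw_pivot /gsw_A /gsw_X take0.
have [E1 E2] := IH (ltnW kn).
rewrite (take_nth false) ?size_tuple // -cats1 foldl_cat /= E1 -gsw_XS //.
by split=> // p; rewrite E2 [RHS]big_nat_recr.
Qed.

Lemma final_state (st := foldl (walk_next M v dir) (walk_start M v) c) :
  st.1 = gsw_output dir c /\ gsw_Z dir c M v = \sum_p st.2 p ^+ 2.
Proof.
have := run_state (leqnn n); rewrite take_oversize ?size_tuple // => -[E1 E2].
rewrite gsw_outputE //; split=> //; rewrite gsw_ZE.
by apply: eq_bigr => p _; rewrite E2.
Qed.

Lemma final_pivot : pivot (gsw_output dir c) = None.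
Proof. by rewrite /gsw_output; apply/pivot_None/gsw_A_T. Qed.

End ZLink.

(** * Expectation over the coins *)

Section Expectation.
Context {R : realType} {d n : nat}.
Variables (M : 'M[R]_(d, n)) (v : 'cV[R]_d).
Variable dir : {set 'I_n} -> 'I_n -> 'cV[R]_n.

Lemma big_tuple_cons k (F : k.+1.-tuple bool -> R) :
  \sum_(c : k.+1.-tuple bool) F c =
  \sum_b \sum_(c : k.-tuple bool) F (cons_tuple b c).
Proof.
rewrite pair_big /=
  (reindex (fun bc : bool * k.-tuple bool => cons_tuple bc.1 bc.2)) //=.
exists (fun c => (thead c, behead_tuple c)) => [[b c] _|c _] /=.
  by congr pair; apply: val_inj.
by rewrite [RHS]tuple_eta; apply: val_inj.
Qed.

Definition path_prob (x : 'cV[R]_n) (l : seq bool) : R :=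
  \prod_(i < size l)
    coin_prob dir (foldl (gsw_step dir) x (take i l)) (nth false l i).

Lemma path_prob_cons x b l :
  path_prob x (b :: l) = coin_prob dir x b * path_prob (gsw_step dir x b) l.
Proof. by rewrite /path_prob big_ord_recl /=. Qed.

Lemma gsw_probE (c : n.-tuple bool) : gsw_prob dir c = path_prob 0 c.
Proof.
rewrite /gsw_prob /path_prob big_add1 /=.
rewrite -(big_mkord xpredT (fun i => coin_prob dir
  (foldl (gsw_step dir) 0 (take i c)) (nth false c i))).
by rewrite size_tuple.
Qed.

Lemma coin_prob_ge0 (x : 'cV[R]_n) b : 0 <= coin_prob dir x b.
Proof.
rewrite /coin_prob; case: pivot => [p|]; last by rewrite invr_ge0.
by rewrite divr_ge0 ?addr_ge0 ?normr_ge0 //; case: b; rewrite normr_ge0.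
Qed.

Hypothesis dirP : direction_rule M dir.

(** The tower property, by induction on the number of remaining coins. *)
Lemma expectation_potential k st : walk_inv M v st ->
  \sum_(c : k.-tuple bool) path_prob st.1 c *
    potential M v (foldl (walk_next M v dir) st c)
  <= potential M v st.
Proof.
elim: k st => [|k IH] st inv.
  rewrite (big_pred1 [tuple]) /=; last by move=> c; apply/esym/eqP/tuple0.
  by rewrite /path_prob big_ord0 mul1r.
rewrite big_tuple_cons; apply: le_trans (potential_step dirP inv).
apply: ler_sum => b _.
rewrite (eq_bigr (fun c : k.-tuple bool => coin_prob dir st.1 b *
   (path_prob (walk_next M v dir st b).1 c *
    potential M v (foldl (walk_next M v dir) (walk_next M v dir st b) c)))).
  rewrite -mulr_sumr ler_wpM2l ?coin_prob_ge0 //; apply: IH.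
  exact: walk_inv_next.
by move=> c _; rewrite path_prob_cons mulrA.
Qed.

Lemma run_inv (l : seq bool) : (forall i : 'I_n, norm2 (col i M) <= 1) ->
  let st := foldl (walk_next M v dir) (walk_start M v) l in
  walk_inv M v st /\ energy_inv M v st.
Proof.
move=> colM; elim/last_ind: l => [|l b] /=.
  by split; [exact: walk_inv_initial|exact: energy_initial].
rewrite foldl_rcons => -[wi ei].
by split; [exact: walk_inv_next|exact: energy_next].
Qed.

End Expectation.

(** * Conclusion *)

Theorem theorem5 (R : realType) (d n : nat) (M : 'M[R]_(d, n))
    (dir : {set 'I_n} -> 'I_n -> 'cV[R]_n) (v : 'cV[R]_d) :
  (forall i : 'I_n, norm2 (col i M) <= 1) ->
  direction_rule M dir ->
  gsw_expectation dir (fun c =>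
    expR (dot (M *m gsw_output dir c) v - 2^-1 * gsw_Z dir c M v)) <= 1 /\
  (forall c : n.-tuple bool, gsw_Z dir c M v <= norm2 v ^+ 2).
Proof.
move=> colM dirP.
have dir_feasible (A : {set 'I_n}) p : p \in A -> feasible A p (dir A p).
  by move=> /dirP[].
split=> [|c].
  apply: le_trans (potential_initial M v).
  have h := expectation_potential dirP n (walk_inv_initial M v).
  apply: le_trans h.
  apply: ler_sum => c _; rewrite gsw_probE /potential.
  have [-> ->] := final_state M v dir_feasible c.
  by rewrite final_pivot // mulr1.
have [_] := run_inv v dirP c colM; rewrite /energy_inv.
have [-> ->] := final_state M v dir_feasible c.
by rewrite final_pivot // norm2_sqr.
Qed.
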